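(* Let $H\le(\mathbb{Z}/2)^3$ be a subgroup of order $4$, with nonzero elements $H\setminus\{0\}=\{e_i,e_j,e_k\}$, and let $W_H=\mathrm{Span}_{\mathbb{R}}\{e_i,e_j,e_k\}\subset\mathbb{R}^7$. (i) If $e_1\in H$, then $W_H$ is a subalgebra of $\mathbb{V}_7$ isomorphic to $\mathbb{V}_3$. There are exactly $3$ such subgroups, namely $\langle e_2,e_3\rangle$, $\langle e_4,e_5\rangle$, $\langle e_6,e_7\rangle$. (ii) If $e_1\notin H$, then $\mathbb{R}e_1\oplus W_H$ is a Jordan subalgebra of $\mathbb{V}_7$ isomorphic to $\mathcal{VJ}_4$, with $a\veebar_7 b=-\langle a,b\rangle e_1$ for $a,b\in W_H$. There are exactly $4$ such subgroups.
   Context: Let $\{e_1,\dots,e_7\}$ be the standard orthonormal basis of $\mathbb{R}^7$ with Euclidean inner product $\langle\cdot,\cdot\rangle$, dual basis $\omega^1,\dots,\omega^7$, and $\omega^{ijk}=\omega^i\wedge\omega^j\wedge\omega^k$. Let $$\Phi=\omega^{123}+\omega^{145}+\omega^{167}+\omega^{246}-\omega^{257}-\omega^{347}-\omega^{356},$$ and let $\times$ be the bilinear cross product on $\mathbb{R}^7$ characterized by $\langle u\times v,w\rangle=\Phi(u,v,w)$. The exceptional Vidinli algebra $\mathbb{V}_7=(\mathbb{R}^7,\veebar_7)$ has the bilinear product $$a\veebar_7 b=\langle a,e_1\rangle b+\langle b,e_1\rangle a-\langle a,b\rangle e_1+\langle e_1,a\times b\rangle e_1 .$$ The basis vectors are identified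 with the nonzero elements of $(\mathbb{Z}/2)^3$ via $e_1\leftrightarrow(1,0,0)$, $e_2\leftrightarrow(0,1,0)$, $e_3\leftrightarrow(1,1,0)$, $e_4\leftrightarrow(0,0,1)$, $e_5\leftrightarrow(1,0,1)$, $e_6\leftrightarrow(0,1,1)$, $e_7\leftrightarrow(1,1,1)$; $\langle e_a,e_b\rangle$ (for two group elements, as a subgroup) denotes the subgroup they generate. The Vidinli algebra $\mathbb{V}_3$ is $\mathbb{R}^3$ with the product $a\veebar b=\langle a,e_1\rangle b+\langle b,e_1\rangle a-\langle a,b\rangle e_1+\langle e_1,a\times b\rangle e_1$, using the standard inner product and cross product of $\mathbb{R}^3$. The Vidinli–Jordan algebra $\mathcal{VJ}_m$ is $\mathbb{R}^m$ with the product $a\circ b=\langle a,e_1\rangle b+\langle b,e_1\rangle a-\langle a,b\rangle e_1$. A Jordan subalgebra means a subalgebra which is a Jordan algebra under the restricted product. *)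

(* Defs.v *)
From HB Require Import structures.
From mathcomp Require Import all_boot all_order all_algebra all_fingroup all_solvable.
From mathcomp Require Import reals ring.

Set Implicit Arguments.
Unset Strict Implicit.
Unset Printing Implicit Defensive.

Import GRing.Theory.
Local Open Scope ring_scope.

(* Finite-dimensional real algebras, not assumed associative or unital: a     *)
(* vector space V with a binary product mul.                                  *)
Section Algebras.
Variable R : fieldType.

Definition bilinear_product (V : lmodType R) (mul : V -> V -> V) : Prop :=
  bilinear_for *:%R *:%R mul.

Definition subalgebra (V : vectType R) (mul : V -> V -> V) (U : {vspace V}) :
  Prop := {in U &, forall x y, mul x y \in U}.

(* When U is a subalgebra the projection vsproj U acts as the identity here;  *)
(* see vsval_restr_mul.                                                       *)
Definition restr_mul (V : vectType R) (mul : V -> V -> V) (U : {vspace V})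
  (x y : subvs_of U) : subvs_of U := vsproj U (mul (vsval x) (vsval y)).

Lemma vsval_restr_mul (V : vectType R) (mul : V -> V -> V) (U : {vspace V}) :
  subalgebra mul U ->
  forall x y : subvs_of U,
    vsval (restr_mul mul x y) = mul (vsval x) (vsval y).
Proof. by move=> subU x y; rewrite vsprojK // subU ?subvsP. Qed.

Definition alg_isomorphic (V W : vectType R)
    (mulV : V -> V -> V) (mulW : W -> W -> W) : Prop :=
  exists f : 'Hom(V, W),
    bijective f /\ forall x y, f (mulV x y) = mulW (f x) (f y).

Definition jordan_algebra (V : lmodType R) (mul : V -> V -> V) : Prop :=
  [/\ bilinear_product mul, commutative mul &
      forall x y, mul (mul x y) (mul x x) = mul x (mul y (mul x x))].

Definition jordan_subalgebra (V : vectType R) (mul : V -> V -> V)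
    (U : {vspace V}) : Prop :=
  subalgebra mul U /\ jordan_algebra (restr_mul mul (U := U)).

End Algebras.

(* Basis vectors are numbered from 1: ev n k is e_k in R^n for 1 <= k <= n,   *)
(* and ev n k = 0 otherwise.                                                  *)
Section Vidinli.
Variable R : realType.

Definition dot n (u v : 'rV[R]_n) : R := \sum_i u 0 i * v 0 i.

Definition ev n (k : nat) : 'rV[R]_n := \row_j (j.+1 == k)%:R.
Arguments ev : clear implicits.

(* omega^i /\ omega^j /\ omega^k, normalized so that its value on             *)
(* (e_i, e_j, e_k) is 1 for distinct i, j, k.                                 *)
Definition omega3 n (i j k : nat) (u v w : 'rV[R]_n) : R :=
  \det (\matrix_(p < 3, q < 3)
          dot (nth 0 [:: u; v; w] p) (ev n (nth 0%N [:: i; j; k] q))).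

Definition Phi (u v w : 'rV[R]_7) : R :=
  omega3 1 2 3 u v w + omega3 1 4 5 u v w + omega3 1 6 7 u v w
  + omega3 2 4 6 u v w - omega3 2 5 7 u v w - omega3 3 4 7 u v w
  - omega3 3 5 6 u v w.

Definition cross7 (u v : 'rV[R]_7) : 'rV[R]_7 := \row_k Phi u v (ev 7 k.+1).

Definition cross3 (u v : 'rV[R]_3) : 'rV[R]_3 :=
  let x (w : 'rV[R]_3) k := dot w (ev 3 k) in
  (x u 2 * x v 3 - x u 3 * x v 2) *: ev 3 1
  + (x u 3 * x v 1 - x u 1 * x v 3) *: ev 3 2
  + (x u 1 * x v 2 - x u 2 * x v 1) *: ev 3 3.

Definition vj_mul n (a b : 'rV[R]_n) : 'rV[R]_n :=
  dot a (ev n 1) *: b + dot b (ev n 1) *: a - dot a b *: ev n 1.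

Definition veebar n (cross : 'rV[R]_n -> 'rV[R]_n -> 'rV[R]_n)
    (a b : 'rV[R]_n) : 'rV[R]_n :=
  dot a (ev n 1) *: b + dot b (ev n 1) *: a - dot a b *: ev n 1
  + dot (ev n 1) (cross a b) *: ev n 1.

Definition veebar3 : 'rV[R]_3 -> 'rV[R]_3 -> 'rV[R]_3 := veebar cross3.
Definition veebar7 : 'rV[R]_7 -> 'rV[R]_7 -> 'rV[R]_7 := veebar cross7.

Lemma dot_ev n (u : 'rV[R]_n) (k : 'I_n) : dot u (ev n k.+1) = u 0 k.
Proof.
rewrite /dot (bigD1 k) //= !mxE eqxx mulr1 big1 ?addr0 // => i neq_ik.
by rewrite mxE eqSS (inj_eq val_inj) (negPf neq_ik) mulr0.
Qed.

Lemma dotDl n (u v w : 'rV[R]_n) : dot (u + v) w = dot u w + dot v w.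
Proof. by rewrite -big_split; apply: eq_bigr => i _; rewrite mxE mulrDl. Qed.

Lemma dotZl n c (u v : 'rV[R]_n) : dot (c *: u) v = c * dot u v.
Proof. by rewrite mulr_sumr; apply: eq_bigr => i _; rewrite mxE mulrA. Qed.

Lemma dotC n (u v : 'rV[R]_n) : dot u v = dot v u.
Proof. by apply: eq_bigr => i _; rewrite mulrC. Qed.

Lemma omega3E n i j k (u v w : 'rV[R]_n) :
  let x (u : 'rV[R]_n) k := dot u (ev n k) in
  omega3 i j k u v w =
    x u i * (x v j * x w k - x v k * x w j)
    - x u j * (x v i * x w k - x v k * x w i)
    + x u k * (x v i * x w j - x v j * x w i).
Proof.
rewrite /= /omega3 (expand_det_row _ 0) !big_ord_recl big_ord0 /cofactor.
rewrite !(expand_det_row _ 0) !big_ord_recl !big_ord0 /cofactor.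
by rewrite !det_mx11 !mxE /= /bump /=; ring.
Qed.

Lemma Phi_linear_r u v c w w' :
  Phi u v (c *: w + w') = c * Phi u v w + Phi u v w'.
Proof. by rewrite /Phi !omega3E !(dotDl, dotZl) /=; ring. Qed.

Lemma Phi_linear_l u u' v c w :
  Phi (c *: u + u') v w = c * Phi u v w + Phi u' v w.
Proof. by rewrite /Phi !omega3E !(dotDl, dotZl) /=; ring. Qed.

Lemma Phi_linear_m u v v' c w :
  Phi u (c *: v + v') w = c * Phi u v w + Phi u v' w.
Proof. by rewrite /Phi !omega3E !(dotDl, dotZl) /=; ring. Qed.

(* cross7 is the unique operation with <u x v, w> = Phi(u, v, w).             *)
Lemma cross7P (f : 'rV[R]_7 -> 'rV[R]_7 -> 'rV[R]_7) :
  (forall u v w, dot (f u v) w = Phi u v w) <-> f =2 cross7.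
Proof.
split=> [fP u v | fE u v w].
  by apply/rowP=> k; rewrite mxE -fP dot_ev.
have Phi0 : Phi u v 0 = 0.
  by have := Phi_linear_r u v (-1) 0 0; rewrite scaler0 addr0 mulN1r addNr.
have PhiD x y : Phi u v (x + y) = Phi u v x + Phi u v y.
  by rewrite -[x in LHS]scale1r Phi_linear_r mul1r.
have PhiZ c x : Phi u v (c *: x) = c * Phi u v x.
  by rewrite -[c *: x]addr0 Phi_linear_r Phi0 addr0.
have wE : w = \sum_(k < 7) w 0 k *: ev 7 k.+1.
  rewrite [LHS]row_sum_delta; apply: eq_bigr => k _; congr (_ *: _).
  by apply/rowP=> j; rewrite !mxE /= eqSS.
rewrite fE [in RHS]wE (big_morph (Phi u v) PhiD Phi0) /dot.
by apply: eq_bigr => k _; rewrite mxE PhiZ mulrC.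
Qed.

Lemma veebar7_bilinear : bilinear_product veebar7.
Proof.
have dotDr n (u v w : 'rV[R]_n) : dot w (u + v) = dot w u + dot w v.
  by rewrite ![dot w _]dotC dotDl.
have dotZr n c (u v : 'rV[R]_n) : dot v (c *: u) = c * dot v u.
  by rewrite ![dot v _]dotC dotZl.
have cross7l v c u u' : cross7 (c *: u + u') v = c *: cross7 u v + cross7 u' v.
  by apply/rowP=> k; rewrite !mxE Phi_linear_l.
have cross7r u c v v' : cross7 u (c *: v + v') = c *: cross7 u v + cross7 u v'.
  by apply/rowP=> k; rewrite !mxE Phi_linear_m.
split=> [b c a a' | a c b b']; rewrite /veebar7 /veebar ?(cross7l, cross7r);
  by rewrite !(dotDl, dotZl, dotDr, dotZr); apply/rowP=> k; rewrite !mxE; ring.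
Qed.

End Vidinli.
Arguments ev : clear implicits.
Arguments ev {R} n k.

Definition Z2cube : finGroupType := ('Z_2 * 'Z_2 * 'Z_2)%type.

(* gv k is the element of (Z/2)^3 identified with e_k, for 1 <= k <= 7.       *)
Definition gv (k : nat) : Z2cube :=
  nth (0, 0, 0) [:: (0, 0, 0); (1, 0, 0); (0, 1, 0); (1, 1, 0);
                    (0, 0, 1); (1, 0, 1); (0, 1, 1); (1, 1, 1)] k.

Definition Wspace (R : realType) (H : {set Z2cube}) : {vspace 'rV[R]_7} :=
  <<[seq ev 7 k | k <- iota 1 7 & gv k \in H]>>%VS.

(* If the nonzero elements of H are the labels of e_i, e_j, e_k, then         *)
(* Wspace H = Span {e_i, e_j, e_k}.                                           *)
Lemma WspaceE (R : realType) (H : {set Z2cube}) (i j k : nat) :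
    i \in iota 1 7 -> j \in iota 1 7 -> k \in iota 1 7 ->
    H :\ (0, 0, 0) = [set gv i; gv j; gv k] ->
  Wspace R H = <<[:: ev 7 i; ev 7 j; ev 7 k]>>%VS.
Proof.
have gv_inj : {in iota 1 7 &, injective gv}.
  have /allP gvP : all (fun a => all (fun b => (gv a == gv b) ==> (a == b))
    (iota 1 7)) (iota 1 7) by vm_compute.
  by move=> a b /gvP/allP + /[swap] gvE => /[apply]; rewrite gvE eqxx => /eqP.
have gv_neq0 a : a \in iota 1 7 -> gv a != (0, 0, 0).
  by move: a; apply/allP; vm_compute.
move=> iP jP kP HE.
apply: (@eq_span _ _ _ (map (ev 7) [:: i; j; k])); apply: eq_mem_map => a.
rewrite mem_filter; apply/idP/idP => [/andP[aH aP] | aE].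
  have : gv a \in H :\ (0, 0, 0) by rewrite in_setD1 aH gv_neq0.
  rewrite HE !inE -orbA.
  by case/or3P=> /eqP/gv_inj -> //; rewrite eqxx ?orbT.
have aP : a \in iota 1 7 by move: aE; rewrite 3!inE => /or3P[] /eqP ->.
rewrite aP andbT; suff : gv a \in H :\ (0, 0, 0) by rewrite inE => /andP[].
move: aE; rewrite HE !inE -orbA.
by case/or3P=> /eqP ->; rewrite eqxx ?orbT.
Qed.

(* Main.v *)
Require Import Defs.
From mathcomp Require Import all_boot all_order all_algebra all_fingroup all_solvable.
From mathcomp Require Import reals ring.

Set Implicit Arguments.
Unset Strict Implicit.
Unset Printing Implicit Defensive.

Import GRing.Theory.
Local Open Scope ring_scope.

(** The product of [V_7] differs from the Vidinli-Jordan product only by the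
    scalar [<e_1, a x b>] in front of [e_1], and of the seven terms of [Phi]
    only the three containing [omega^1] contribute to that scalar.  It is thus
    the alternating form [e1_form] that pairs [e_2] with [e_3], [e_4] with
    [e_5] and [e_6] with [e_7] ([veebar7E]).  For a
    coordinate subspace of [V_7] what matters is therefore which of these three
    pairs it contains.

    The subgroups of order 4 of (Z/2)^3 are the lines of the Fano plane: such a
    subgroup is known from the labels of its three nonzero elements, and these
    form one of the seven triples of [fano] ([line_of_fano], [line_of_inj]).
    Counting and listing subgroups then means filtering [fano] ([mem_order4],
    [card_order4]).  The three lines through [1] are the three pairs completed
    by [1]; a line that avoids [1] contains no pair, since the label [1] lies on
    the line through the two elements of a pair.

    To identify a coordinate subspace with a standard algebra, R^m is embedded
    isometrically in R^7 by sending its basis to the chosen basis vectors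
    ([basis_embedding]).  An isometry fixing [e_1] preserves the Vidinli-Jordan
    product ([basis_embedding_vj]), so only the forms remain to be compared.  On
    a line through [1] there is exactly one pair, and the form is that of
    [V_3].  On the span of [e_1] and a line that avoids [1] the form vanishes,
    so the product is the one of [VJ_4]; its Jordan identity, [vj_mul_jordan],
    holds because [x o x] is a combination of [x] and the unit [e_1]. *)

(** * Subgroups of order 4 as lines of the Fano plane *)

(** The triples are the index sets of the terms of [Phi]; in this numbering
    they are also the triples whose elements of (Z/2)^3 add up to 0. *)
Definition fano : seq (seq nat) :=
  [:: [:: 1; 2; 3]; [:: 1; 4; 5]; [:: 1; 6; 7]; [:: 2; 4; 6];
      [:: 2; 5; 7]; [:: 3; 4; 7]; [:: 3; 5; 6]]%N.

Definition line_of (H : {set Z2cube}) : seq nat :=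
  [seq k <- iota 1 7 | gv k \in H].

(** Any two nonzero elements generate the subgroup; for the lines through 1 in
    [fano] the last two are those of a pair completed by [e_1]. *)
Definition line_group (l : seq nat) : {group Z2cube} :=
  <<[set gv (nth 0 l 1); gv (nth 0 l 2)]>>%G.

Lemma gv_surj (x : Z2cube) : x \in map gv (iota 0 8).
Proof.
by case: x => [[[[|[|//]] ?] [[|[|//]] ?]] [[|[|//]] ?]]; vm_compute.
Qed.

Lemma mem_line_of (H : {set Z2cube}) k :
  (k \in line_of H) = (gv k \in H) && (k \in iota 1 7).
Proof. by rewrite mem_filter. Qed.

Lemma Z2cube_mulxx (x : Z2cube) : (x * x = 1)%g.
Proof.
have /mapP[k + ->] := gv_surj x.
have /allP + : all (fun k => gv k * gv k == 1)%g (iota 0 8) by vm_compute.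
by move=> /[apply]/eqP.
Qed.

Lemma Z2cube_mulC : commutative (fun x y : Z2cube => (x * y)%g).
Proof. by move=> [[a b] c] [[x y] z]; congr (_, _, _); apply: addrC. Qed.

(** In an abelian group of exponent 2 the four listed elements are closed under
    the product; this makes membership in a [line_group] decidable by
    computation, which the generated subgroup itself is not. *)
Lemma mem_gen2 (x y z : Z2cube) :
  (z \in <<[set x; y]>>%g) = (z \in [:: 1; x; y; x * y])%g.
Proof.
have gS : group_set [set u in [:: 1; x; y; x * y]%g].
  apply/group_setP; split=> [|u v]; first by rewrite !inE eqxx.
  have xyx : (x * y * x = y)%g by rewrite Z2cube_mulC mulgA Z2cube_mulxx mul1g.
  have yxy : (y * (x * y) = x)%g.
    by rewrite [(x * y)%g]Z2cube_mulC mulgA Z2cube_mulxx mul1g.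
  rewrite ![_ \in [set _ in _]]inE !in_cons !in_nil !orbF.
  case/or4P=> /eqP-> /or4P[]/eqP->;
  rewrite ?(mul1g, mulg1, Z2cube_mulxx, xyx, yxy) ?eqxx ?orbT //.
  - by rewrite mulgA Z2cube_mulxx mul1g eqxx ?orbT.
  - by rewrite Z2cube_mulC eqxx ?orbT.
  - by rewrite -mulgA Z2cube_mulxx mulg1 eqxx ?orbT.
apply/idP/idP => [|zS].
  have /subsetP sub : <<[set x; y]>>%g \subset Group gS.
    by rewrite gen_subG; apply/subsetP=> u; rewrite !inE => /orP[]/eqP->;
       rewrite eqxx ?orbT.
  by move=> /sub; rewrite inE.
have xG : x \in <<[set x; y]>>%g by rewrite mem_gen ?inE ?eqxx.
have yG : y \in <<[set x; y]>>%g by rewrite mem_gen ?inE ?eqxx ?orbT.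
move: zS; rewrite !in_cons in_nil orbF.
case/or4P=> /eqP-> //.
exact: (@groupM _ <<[set x; y]>>%G).
Qed.

(** Only the identity, labelled 0, is left out of [line_of H]. *)
Lemma card_line_of (H : {group Z2cube}) : #|H| = (size (line_of H)).+1.
Proof.
have gv_uniq : uniq (map gv (iota 0 8)) by vm_compute.
have -> : #|H| = size (filter (mem H) (map gv (iota 0 8))).
  rewrite -(card_uniqP (filter_uniq _ gv_uniq)); apply: eq_card => x.
  by rewrite mem_filter gv_surj andbT.
by rewrite filter_map size_map /= -[gv 0]/(1%g : Z2cube) group1.
Qed.

(** If two labels of a triple of [fano] belong to [H], so does the third.  A set
    of three labels with this closure property is a triple of [fano], as an
    inspection of the subsets of the seven labels shows. *)
Lemma line_of_fano (H : {group Z2cube}) : #|H| = 4%N -> line_of H \in fano.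
Proof.
rewrite card_line_of => /eq_add_S.
have closed i j k : (gv i * gv j)%g == gv k ->
  (gv i \in H) && (gv j \in H) ==> (gv k \in H).
  by move=> /eqP<-; apply/implyP=> /andP[]; apply: groupM.
have closed_line l : l \in fano ->
  let h p := gv (nth 0%N l p) \in H in
    [&& h 0 && h 1 ==> h 2, h 1 && h 2 ==> h 0 & h 0 && h 2 ==> h 1]%N.
  by rewrite !inE; do !case/orP; move=> /eqP-> /=; rewrite !closed.
have /allP := closed_line; rewrite /fano /=.
rewrite /line_of /=.
case: (gv 1 \in H); case: (gv 2 \in H); case: (gv 3 \in H); case: (gv 4 \in H);
case: (gv 5 \in H); case: (gv 6 \in H); case: (gv 7 \in H) => //=; by do ?case.
Qed.

Lemma line_groupK :
  {in fano, cancel (fun l => line_group l : {set Z2cube}) line_of}.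
Proof.
have E l : line_of (line_group l) = let x := gv (nth 0 l 1) in
  let y := gv (nth 0 l 2) in
  [seq k <- iota 1 7 | gv k \in [:: 1; x; y; x * y]%g].
  by apply: eq_filter => k; rewrite mem_gen2.
by move=> l lF; apply/eqP; rewrite E; move: l lF; apply/allP; vm_compute.
Qed.

Lemma line_of_inj (H K : {group Z2cube}) : line_of H = line_of K -> H = K.
Proof.
move=> eqHK; apply/val_inj/setP => x /=.
have /mapP[[_ ->|k kP ->]] := gv_surj x.
  by rewrite -[gv 0]/(1%g : Z2cube) !group1.
have kI : k.+1 \in iota 1 7 by move: kP; rewrite !mem_iota.
by have := mem_line_of H k.+1; rewrite eqHK mem_line_of kI !andbT.
Qed.

Lemma card_line_group l : l \in fano -> #|line_group l| = 4%N.
Proof.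
move=> lF; rewrite card_line_of line_groupK //; congr _.+1.
by apply/eqP; move: l lF; apply/allP; vm_compute.
Qed.

Lemma line_groupE (H : {group Z2cube}) :
  #|H| = 4%N -> line_group (line_of H) = H.
Proof. by move=> cH; apply: line_of_inj; rewrite line_groupK ?line_of_fano. Qed.

(** A condition on the labels of [H] turns the subgroups of order 4 that satisfy
    it into an explicit list. *)
Lemma mem_order4 (P : pred (seq nat)) (H : {group Z2cube}) :
  (#|H| == 4%N) && P (line_of H) = (H \in map line_group (filter P fano)).
Proof.
apply/andP/mapP => [[/eqP cH PH] | [l + ->]].
  by exists (line_of H); rewrite ?line_groupE // mem_filter PH line_of_fano.
by rewrite mem_filter => /andP[Pl lF]; rewrite card_line_group // line_groupK.
Qed.

Lemma card_order4 (P : pred (seq nat)) :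
  #|[set H : {group Z2cube} | (#|H| == 4%N) && P (line_of H)]| = count P fano.
Proof.
rewrite -size_filter -(size_map line_group).
rewrite -(card_uniqP _); last first.
  rewrite map_inj_in_uniq ?filter_uniq // => l l'.
  rewrite !mem_filter => /andP[_ lF] /andP[_ lF'] e.
  by rewrite -(line_groupK lF) e line_groupK.
by apply: eq_card => H; rewrite inE mem_order4.
Qed.

(** * Subalgebras obtained from multiplicative embeddings *)

(** An injective multiplicative map makes its image a subalgebra isomorphic to
    its source, so that a subspace is identified by exhibiting a map onto it. *)
Lemma limg_isomorphic (K : fieldType) (V W : vectType K)
    (mulV : V -> V -> V) (mulW : W -> W -> W) (g : 'Hom(W, V)) :
    injective g -> (forall x y, g (mulW x y) = mulV (g x) (g y)) ->
  subalgebra mulV (limg g) /\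
  alg_isomorphic (restr_mul mulV (U := limg g)) mulW.
Proof.
move=> g_inj gM.
have subg : subalgebra mulV (limg g).
  by move=> _ _ /memv_imgP[x _ ->] /memv_imgP[y _ ->];
    rewrite -gM memv_img ?memvf.
have gK : cancel g g^-1%VF by apply/lker0_lfunK/lker0P.
have gKV (u : subvs_of (limg g)) : g (g^-1%VF (vsval u)) = vsval u.
  by have /memv_imgP[x _ ->] := subvsP u; rewrite gK.
split=> //; exists (g^-1 \o linfun vsval)%VF.
have fE u : (g^-1 \o linfun vsval)%VF u = g^-1%VF (vsval u) :> W.
  by rewrite comp_lfunE lfunE.
split=> [|x y].
  exists (fun w => vsproj (limg g) (g w)) => [u | w]; rewrite fE.
    by rewrite gKV vsvalK.
  by rewrite vsprojK ?gK ?memv_img ?memvf.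
by rewrite !fE vsval_restr_mul // -[in LHS]gKV -[vsval y in LHS]gKV -gM gK.
Qed.

Lemma alg_isomorphic_jordan (K : fieldType) (V W : vectType K)
    (mulV : V -> V -> V) (mulW : W -> W -> W) :
  alg_isomorphic mulV mulW -> jordan_algebra mulW -> jordan_algebra mulV.
Proof.
move=> [f [/bij_inj f_inj fM]] [[mulDl mulDr] mulC jordanW].
split=> [|x y|x y]; last 2 first.
- by apply: f_inj; rewrite !fM mulC.
- by apply: f_inj; rewrite !fM jordanW.
have fL c u v : f (c *: u + v) = c *: f u + f v by rewrite linearP.
split=> u c v w; apply: f_inj; rewrite !(fM, fL); first exact: mulDl.
exact: mulDr.
Qed.

(** * Vidinli-Jordan products and coordinate embeddings *)

Section Vidinli.
Variable R : realType.

Lemma dotDr n (u v w : 'rV[R]_n) : dot w (u + v) = dot w u + dot w v.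
Proof. by rewrite ![dot w _]dotC dotDl. Qed.

Lemma dotZr n c (u v : 'rV[R]_n) : dot v (c *: u) = c * dot v u.
Proof. by rewrite ![dot v _]dotC dotZl. Qed.

Lemma dot0l n (v : 'rV[R]_n) : dot 0 v = 0.
Proof. by rewrite /dot big1 // => i _; rewrite mxE mul0r. Qed.

Lemma dot_ev_out n k (u : 'rV[R]_n) : k \notin iota 1 n -> dot u (ev n k) = 0.
Proof.
move=> kn; rewrite /dot big1 // => j _; rewrite mxE.
case: eqP => [jk|]; last by rewrite mulr0.
by case/negP: kn; rewrite -jk mem_iota /= add1n ltnS ltn_ord.
Qed.

Lemma dot_evv n (i j : nat) : i \in iota 1 n ->
  dot (ev n i) (ev n j) = (i == j)%:R :> R.
Proof.
case: i => [|i]; rewrite mem_iota //= add1n ltnS => lt_in.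
by rewrite dotC (dot_ev _ (Ordinal lt_in)) mxE.
Qed.

Lemma vj_mulC n : commutative (@vj_mul R n).
Proof. by move=> a b; rewrite /vj_mul [_ + _ *: a]addrC [dot b a]dotC. Qed.

Lemma vj_mulDl n (b u v : 'rV[R]_n) :
  vj_mul (u + v) b = vj_mul u b + vj_mul v b.
Proof.
by rewrite /vj_mul !(dotDl, dotDr); apply/rowP=> k; rewrite !mxE; ring.
Qed.

Lemma vj_mulZl n c (b u : 'rV[R]_n) : vj_mul (c *: u) b = c *: vj_mul u b.
Proof.
by rewrite /vj_mul !(dotZl, dotZr); apply/rowP=> k; rewrite !mxE; ring.
Qed.

(** As [e_1] is a unit, [x o x = 2 <x, e_1> x - <x, x> e_1] is a combination of
    [x] and the unit, so multiplication by [x o x] is a combination of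
    multiplication by [x] and the identity, and commutes with multiplication by
    [x]. *)
Lemma vj_mul_jordan n : jordan_algebra (@vj_mul R n.+1).
Proof.
split; [|exact: vj_mulC|].
  by split=> b c u v; rewrite ?[vj_mul b _]vj_mulC vj_mulDl vj_mulZl.
move=> x y.
have e_unit (z : 'rV[R]_n.+1) : vj_mul (ev n.+1 1) z = z.
  by rewrite /vj_mul dot_evv // scale1r [dot z _]dotC addrK.
have xx : vj_mul x x = (dot x (ev n.+1 1) *+ 2) *: x + (- dot x x) *: ev n.+1 1.
  by rewrite scaleNr mulr2n scalerDl.
set t := _ *+ 2 in xx; set N := - _ in xx.
have mul_xx (z : 'rV[R]_n.+1) :
  vj_mul z (vj_mul x x) = t *: vj_mul z x + N *: z.
  by rewrite vj_mulC xx vj_mulDl !vj_mulZl e_unit [vj_mul x z]vj_mulC.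
by rewrite !mul_xx [RHS]vj_mulC [RHS]vj_mulDl !vj_mulZl [vj_mul y x]vj_mulC.
Qed.

Definition basis_mx n m (s : seq nat) : 'M[R]_(m, n) :=
  \matrix_(p < m) ev n (nth 0%N s p).

Section BasisEmbedding.
Variables (n : nat) (s : seq nat).
Hypotheses (s_uniq : uniq s) (s_sub : {subset s <= iota 1 n}).
Local Notation m := (size s).

(** The isometry from R^m to R^n that maps [e_(p+1)] to [e_k], where [k] is the
    entry of [s] at position [p]. *)
Definition basis_embedding : 'Hom('rV[R]_m, 'rV[R]_n) :=
  linfun (mulmxr (basis_mx n m s)).
Local Notation g := basis_embedding.

Lemma basis_embeddingE v :
  g v = \sum_(p < m) v 0 p *: ev n (nth 0%N s p).
Proof.
by rewrite lfunE /= mulmx_sum_row; apply: eq_bigr => p _; rewrite rowK.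
Qed.

Lemma basis_embedding_dot v w : dot (g v) (g w) = dot v w.
Proof.
have dotE k (a b : 'rV[R]_k) : dot a b = (a *m b^T) 0 0.
  by rewrite mxE; apply: eq_bigr => i _; rewrite mxE.
have orth : basis_mx n m s *m (basis_mx n m s)^T = 1%:M.
  apply/matrixP => p q; rewrite !mxE.
  have sP (r : 'I_m) : nth 0%N s r \in iota 1 n by rewrite s_sub // mem_nth.
  rewrite (eq_bigr (fun j => ev n (nth 0%N s p) 0 j * ev n (nth 0%N s q) 0 j)).
    by rewrite -/(dot _ _) dot_evv // nth_uniq.
  by move=> j _; rewrite !mxE.
by rewrite !dotE !lfunE /= trmx_mul mulmxA -(mulmxA v) orth mulmx1.
Qed.

Lemma basis_embedding_inj : injective g.
Proof.
move=> v w /(congr1 (fun x => x - g w)); rewrite subrr -linearB => gvw.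
apply/rowP=> p; apply/eqP; rewrite -subr_eq0.
by have := basis_embedding_dot (v - w) (ev m p.+1);
  rewrite gvw dot_ev !mxE dot0l => <-.
Qed.

Lemma basis_embedding_ev k : k \in s -> g (ev m (index k s).+1) = ev n k.
Proof.
rewrite -index_mem => lt_km.
rewrite basis_embeddingE (bigD1 (Ordinal lt_km)) //=.
rewrite big1 => [|p neq_pk].
  by rewrite mxE eqxx scale1r addr0 nth_index // -index_mem.
by rewrite mxE eqSS (inj_eq val_inj p (Ordinal lt_km)) (negPf neq_pk) scale0r.
Qed.

(** For [k] outside [s] the index is [size s], and both sides vanish because
    [ev m m.+1] is 0. *)
Lemma dot_basis_embedding v k :
  dot (g v) (ev n k) = dot v (ev m (index k s).+1).
Proof.
have [ks | ks] := boolP (k \in s).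
  by rewrite -(basis_embedding_ev ks) basis_embedding_dot.
rewrite [RHS]dot_ev_out; last by rewrite memNindex // mem_iota add1n ltnn andbF.
rewrite basis_embeddingE.
rewrite (big_morph (fun x => dot x (ev n k))
  (fun u v => dotDl u v _) (dot0l _)).
rewrite big1 // => p _; rewrite dotZl dot_evv ?s_sub ?mem_nth //.
by case: eqP ks => [<-|]; rewrite ?mem_nth // mulr0.
Qed.

Lemma limg_basis_embedding : limg g = <<[seq ev n k | k <- s]>>%VS.
Proof.
apply/eqP; rewrite eqEsubv; apply/andP; split; last first.
  apply/span_subvP => _ /mapP[k ks ->].
  by rewrite -(basis_embedding_ev ks) memv_img ?memvf.
apply/subvP=> x; case/memv_imgP=> v _ ->; rewrite basis_embeddingE.
by apply: memv_suml => p _; rewrite memvZ ?memv_span ?map_f ?mem_nth.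
Qed.

Lemma dot_span_ev (v : 'rV[R]_n) k :
  v \in <<[seq ev n k | k <- s]>>%VS -> k \notin s -> dot v (ev n k) = 0.
Proof.
rewrite -limg_basis_embedding => /memv_imgP[w _ ->] ks.
rewrite dot_basis_embedding dot_ev_out // memNindex //.
by rewrite mem_iota add1n ltnn andbF.
Qed.

Lemma basis_embedding_vj : index 1%N s = 0%N -> 1%N \in s ->
  forall a b, g (vj_mul a b) = vj_mul (g a) (g b).
Proof.
move=> i1 s1 a b; have := basis_embedding_ev s1; rewrite i1 => e1.
by rewrite /vj_mul linearB linearD !linearZ /= e1 -e1 !basis_embedding_dot.
Qed.

End BasisEmbedding.

(** * The form <e_1, a x b> on the lines *)

(** The contraction of [Phi] by [e_1], that is
    omega^23 + omega^45 + omega^67; it equals [<e_1, a x b>]. *)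
Definition e1_form (a b : 'rV[R]_7) : R :=
  let x (u : 'rV[R]_7) k := dot u (ev 7 k) in
  x a 2 * x b 3 - x a 3 * x b 2 + (x a 4 * x b 5 - x a 5 * x b 4)
  + (x a 6 * x b 7 - x a 7 * x b 6).

Lemma veebar7E (a b : 'rV[R]_7) :
  veebar7 a b = vj_mul a b + e1_form a b *: ev 7 1.
Proof.
have e1_cross : dot (ev 7 1) (cross7 a b) = Phi a b (ev 7 1).
  by rewrite dotC (dot_ev _ (ord0 : 'I_7)) mxE.
rewrite /veebar7 /veebar e1_cross /Phi !omega3E /= !dot_evv //=.
by congr (_ + _ *: _); rewrite /e1_form; ring.
Qed.

Lemma veebar3E (a b : 'rV[R]_3) :
  veebar3 a b = vj_mul a b +
  (dot a (ev 3 2) * dot b (ev 3 3) - dot a (ev 3 3) * dot b (ev 3 2)) *: ev 3 1.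
Proof.
rewrite /veebar3 /veebar /cross3 !(dotDr, dotZr) !dot_evv //=.
by congr (_ + _ *: _); ring.
Qed.

Lemma line_through_e1 l : l \in fano -> 1%N \in l ->
  exists2 i, i \in [:: 2; 4; 6]%N & l = [:: 1; i; i.+1]%N.
Proof.
rewrite !inE; do !case/orP; move=> /eqP-> // _;
by [exists 2%N | exists 4%N | exists 6%N].
Qed.

Lemma fano_uniq l : l \in fano -> uniq l.
Proof. by move: l; apply/allP. Qed.

Lemma fano_sub l : l \in fano -> {subset l <= iota 1 7}.
Proof.
by move=> lF; apply/allP; move: l lF; apply/allP.
Qed.

(** Among the coordinates entering [e1_form], those of the embedded vectors
    vanish for the two pairs off the line, and the third pair gives the form of
    [V_3]. *)
Lemma line_through_e1_subalgebra l : l \in fano -> 1%N \in l ->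
  let W := <<[seq ev 7 k | k <- l]>>%VS in
  subalgebra (@veebar7 R) W /\
  alg_isomorphic (restr_mul (@veebar7 R) (U := W)) (@veebar3 R).
Proof.
move=> lF l1 /=; rewrite -limg_basis_embedding.
have [i i246 lE] := line_through_e1 lF l1.
move: (lF) l1; rewrite lE => {}lF l1.
pose g := basis_embedding 7 [:: 1%N; i; i.+1].
have [lU lS] := (fano_uniq lF, fano_sub lF).
apply: (limg_isomorphic (g := g)) => [|a b]; first exact: basis_embedding_inj.
rewrite veebar3E veebar7E -(basis_embedding_vj lU lS) //.
rewrite linearD linearZ /=; congr (_ + _ *: _); last first.
  exact: (basis_embedding_ev 7 (mem_head 1%N [:: i; i.+1])).
rewrite /e1_form !(dot_basis_embedding lU lS) /=; move: i246; rewrite !inE.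
(* [ev 3 4] is what the embedding pulls [e_k] back to for [k] off the line. *)
have out u : dot u (ev 3 4) = 0 :> R by rewrite dot_ev_out.
by case/or3P=> /eqP-> /=; rewrite !out mulr0 subrr ?addr0 ?add0r.
Qed.

(** Adding 1 to a line that avoids it still completes none of the three pairs,
    so each term of [e1_form] has a vanishing factor. *)
Lemma e1_form0 l (a b : 'rV[R]_7) : l \in fano -> 1%N \notin l ->
  (forall k, k \notin 1%N :: l -> dot a (ev 7 k) = 0) ->
  (forall k, k \notin 1%N :: l -> dot b (ev 7 k) = 0) -> e1_form a b = 0.
Proof.
move=> lF l1 a0 b0.
have pair i : i \in [:: 2; 4; 6]%N ->
  dot a (ev 7 i) * dot b (ev 7 i.+1) - dot a (ev 7 i.+1) * dot b (ev 7 i) = 0.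
  move=> i246; have : (i \notin 1%N :: l) || (i.+1 \notin 1%N :: l).
    by move: lF l1 i246; rewrite !inE; do !case/orP; move=> /eqP-> // _;
       do !case/orP; move=> /eqP->.
  by case/orP=> il; rewrite ?(a0 _ il) ?(b0 _ il) ?(mulr0, mul0r) subrr.
by rewrite /e1_form !pair // !addr0.
Qed.

(** The span of [e_1] and the line is the image of [VJ_4] under an isometry that
    is multiplicative because [e1_form] vanishes on it. *)
Lemma line_off_e1_jordan l : l \in fano -> 1%N \notin l ->
  let W := <<[seq ev 7 k | k <- l]>>%VS in
  [/\ directv (<[ev 7 1]> + W)%VS,
      jordan_subalgebra (@veebar7 R) (<[ev 7 1]> + W)%VS,
      alg_isomorphic (restr_mul (@veebar7 R) (U := (<[ev 7 1]> + W)%VS))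
        (@vj_mul R 4)
    & {in W &, forall a b, veebar7 a b = - dot a b *: ev 7 1}].
Proof.
move=> lF l1 W; have [lU lS] := (fano_uniq lF, fano_sub lF).
pose s := 1%N :: l.
have sU : uniq s by rewrite /= l1.
have sS : {subset s <= iota 1 7}.
  by move=> k; rewrite inE => /predU1P[-> //|]; apply: lS.
have W1 a : a \in W -> dot a (ev 7 1) = 0.
  by move=> aW; apply: (dot_span_ev lU lS aW).
have sizel : size l = 3%N.
  by apply/eqP; move: l lF {l1 W lU lS s sU sS W1}; apply/allP.
pose g : 'Hom('rV_(size s), 'rV_7) := basis_embedding 7 s.
have gimg : limg g = (<[ev 7 1]> + W)%VS.
  by rewrite limg_basis_embedding // -span_cons.
have gM a b : g (vj_mul a b) = veebar7 (g a) (g b).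
  have g_off c k : k \notin s -> dot (g c) (ev 7 k) = 0.
    apply: (dot_span_ev sU sS).
    by rewrite -limg_basis_embedding memv_img ?memvf.
  rewrite veebar7E (e1_form0 lF l1 (g_off a) (g_off b)) scale0r addr0.
  by rewrite /g basis_embedding_vj ?inE ?eqxx.
have [subU isoU] := limg_isomorphic (basis_embedding_inj sU sS) gM.
(* The dimension [size s] has to become the numeral 4 of the statement. *)
move: subU isoU; rewrite -/g gimg /s /= sizel => subU isoU.
split; [|split|exact: isoU|]; [|exact: subU|..].
- apply/directv_addP/eqP; rewrite -subv0; apply/subvP => v.
  rewrite memv_cap memv0 => /andP[/vlineP[c ->] /W1].
  by rewrite dotZl dot_evv // mulr1 => ->; rewrite scale0r.
- exact: alg_isomorphic_jordan isoU (vj_mul_jordan 3).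
have off c k : c \in W -> k \notin s -> dot c (ev 7 k) = 0.
  by move=> cW /norP[_]; apply: (dot_span_ev lU lS).
move=> a b aW bW.
have e1_form_ab0 : e1_form a b = 0.
  by apply: (e1_form0 lF l1) => k; apply: off.
rewrite veebar7E e1_form_ab0 scale0r addr0.
by rewrite /vj_mul !W1 // !scale0r add0r sub0r scaleNr.
Qed.

End Vidinli.

Theorem theorem4p5 (R : realType) :
  ((forall H : {group Z2cube}, #|H| = 4%N -> gv 1 \in H ->
      subalgebra (@veebar7 R) (Wspace R H) /\
      alg_isomorphic (restr_mul (@veebar7 R) (U := Wspace R H)) (@veebar3 R)) /\
   #|[set H : {group Z2cube} | (#|H| == 4%N) && (gv 1 \in H)]| = 3%N /\
   [set H : {group Z2cube} | (#|H| == 4%N) && (gv 1 \in H)] =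
     [set <<[set gv 2; gv 3]>>%G; <<[set gv 4; gv 5]>>%G;
          <<[set gv 6; gv 7]>>%G])
  /\
  ((forall H : {group Z2cube}, #|H| = 4%N -> gv 1 \notin H ->
      [/\ directv (<[ev 7 1]> + Wspace R H)%VS,
          jordan_subalgebra (@veebar7 R) (<[ev 7 1]> + Wspace R H)%VS,
          alg_isomorphic
            (restr_mul (@veebar7 R) (U := (<[ev 7 1]> + Wspace R H)%VS))
            (@vj_mul R 4)
        & {in Wspace R H &, forall a b,
             veebar7 a b = - dot a b *: ev 7 1}]) /\
   #|[set H : {group Z2cube} | (#|H| == 4%N) && (gv 1 \notin H)]| = 4%N).
Proof.
have e1_line (H : {group Z2cube}) : (gv 1 \in H) = (1%N \in line_of H).
  by rewrite mem_line_of andbT.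
split; split=> [H cH H1|].
- by apply: line_through_e1_subalgebra; rewrite ?line_of_fano -?e1_line.
- under eq_finset do rewrite e1_line; split.
    exact: (card_order4 (fun l => 1%N \in l)).
  apply/setP=> H; rewrite inE (mem_order4 (fun l => 1%N \in l)) /= !inE.
  by rewrite orbA.
- by apply: line_off_e1_jordan; rewrite ?line_of_fano -?e1_line.
- under eq_finset do rewrite e1_line.
  exact: (card_order4 (fun l => 1%N \notin l)).
Qed.
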